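(* Let $k$ be an algebraically closed field of characteristic zero, let $H$ be a Hopf algebra over $k$, and let $A, L\subseteq H$ be Hopf subalgebras such that $(A,L)$ is a factorization of $H$. Suppose that both $A$ and $L$ are normal Hopf subalgebras of $H$. Then $H\cong A\otimes L$ as Hopf algebras via the multiplication map $a\otimes l\mapsto al$.
   Context: A Hopf subalgebra $A\subseteq H$ is normal if $h_1 A S(h_2)\subseteq A$ and $S(h_1)Ah_2\subseteq A$ for all $h\in H$ (Sweedler notation, $S$ the antipode). For Hopf subalgebras $A,L$ of $H$, $(A,L)$ is a factorization of $H$ if the multiplication map $A\otimes L\to H$, $a\otimes l\mapsto al$, is bijective (equivalently, $H$ is a bicrossed product of $A$ and $L$ via multiplication). $A\otimes L$ carries the usual tensor product Hopf algebra structure. *)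

(* Defs.v *)
From HB Require Import structures.
From mathcomp Require Import all_boot all_order all_algebra.
From mathcomp Require Import generic_quotient.
From mathcomp Require Import boolp classical_sets.

Set Implicit Arguments.
Unset Strict Implicit.
Unset Printing Implicit Defensive.

Import GRing.Theory.
Local Open Scope ring_scope.
Local Open Scope quotient_scope.

Reserved Notation "u \ox v" (at level 40, left associativity).

Notation bilin f := (bilinear_for *:%R *:%R f).

(* The tensor product of two vector spaces: formal finite sums of pairs       *)
(* modulo the congruence generated by bilinearity.                            *)

Section TensorDef.
Variables (k : fieldType) (U V : lmodType k).

Inductive tens_rel : seq (U * V) -> seq (U * V) -> Prop :=
| tens_refl s : tens_rel s s
| tens_sym s t : tens_rel s t -> tens_rel t s
| tens_trans s t r : tens_rel s t -> tens_rel t r -> tens_rel s r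
| tens_cat s s' t t' :
    tens_rel s s' -> tens_rel t t' -> tens_rel (s ++ t) (s' ++ t')
| tens_catC s t : tens_rel (s ++ t) (t ++ s)
| tens_addl u u' v : tens_rel [:: (u + u', v)] [:: (u, v); (u', v)]
| tens_addr u v v' : tens_rel [:: (u, v + v')] [:: (u, v); (u, v')]
| tens_scale a u v : tens_rel [:: (a *: u, v)] [:: (u, a *: v)]
| tens_zero v : tens_rel [:: (0, v)] [::].

Definition tens_relb s t := `[< tens_rel s t >].

Lemma tens_relb_equiv : equiv_class_of tens_relb.
Proof.
split=> [s|s t|t s r]; first by apply/asboolP; exact: tens_refl.
  by apply/idP/idP=> /asboolP st; apply/asboolP; exact: tens_sym.
by move=> /asboolP st /asboolP tr; apply/asboolP; exact: tens_trans tr.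
Qed.

Canonical tens_equiv := EquivRelPack tens_relb_equiv.

Definition tensor := {eq_quot tens_equiv}.

HB.instance Definition _ := Choice.on tensor.
HB.instance Definition _ := EqQuotient.on tensor.

Definition tclass (s : seq (U * V)) : tensor := \pi_tensor s.

Definition tpure (u : U) (v : V) : tensor := tclass [:: (u, v)].

Lemma tclassP s t : tclass s = tclass t <-> tens_rel s t.
Proof.
split=> [/eqmodP /asboolP //|st]; apply/eqmodP; exact/asboolP.
Qed.

Lemma repr_tclass s : tens_rel (repr (tclass s)) s.
Proof. by apply/tclassP; rewrite /tclass reprK. Qed.

Lemma tclassK (x : tensor) : tclass (repr x) = x.
Proof. exact: reprK. Qed.

Definition tadd (x y : tensor) : tensor := tclass (repr x ++ repr y).
Definition tzero : tensor := tclass [::].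
Definition tscale (a : k) (x : tensor) : tensor :=
  tclass [seq (a *: p.1, p.2) | p <- repr x].

Lemma tadd_class s t : tadd (tclass s) (tclass t) = tclass (s ++ t).
Proof. by apply/tclassP; apply: tens_cat; exact: repr_tclass. Qed.

Lemma tens_rel_scale a s t : tens_rel s t ->
  tens_rel [seq (a *: p.1, p.2) | p <- s] [seq (a *: p.1, p.2) | p <- t].
Proof.
elim=> {s t} //=.
- by move=> s; exact: tens_refl.
- by move=> s t _; exact: tens_sym.
- by move=> s t r _ h _; exact: tens_trans h.
- by move=> *; rewrite !map_cat; exact: tens_cat.
- by move=> *; rewrite !map_cat; exact: tens_catC.
- by move=> u u' v; rewrite scalerDr; exact: tens_addl.
- by move=> *; exact: tens_addr.
- by move=> b u v; rewrite scalerA mulrC -scalerA; exact: tens_scale.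
- by move=> v; rewrite scaler0; exact: tens_zero.
Qed.

Lemma tscale_class a s :
  tscale a (tclass s) = tclass [seq (a *: p.1, p.2) | p <- s].
Proof. by apply/tclassP; apply: tens_rel_scale; exact: repr_tclass. Qed.

Lemma tensor_class_ind (P : tensor -> Prop) :
  (forall s, P (tclass s)) -> forall x, P x.
Proof. by move=> Ps x; rewrite -(tclassK x). Qed.

Lemma taddA : associative tadd.
Proof.
elim/tensor_class_ind=> s; elim/tensor_class_ind=> t.
by elim/tensor_class_ind=> r; rewrite !tadd_class catA.
Qed.

Lemma taddC : commutative tadd.
Proof.
elim/tensor_class_ind=> s; elim/tensor_class_ind=> t.
by rewrite !tadd_class; apply/tclassP; exact: tens_catC.
Qed.

Lemma tadd0 : left_id tzero tadd.
Proof. by elim/tensor_class_ind=> s; rewrite tadd_class. Qed.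

Lemma tscale0s s : tens_rel [seq (0 *: p.1, p.2) | p <- s] [::].
Proof.
elim: s => [|p s IHs] /=; first exact: tens_refl.
rewrite -cat1s -[X in tens_rel _ X]/([::] ++ [::]); apply: tens_cat => //.
by rewrite scale0r; exact: tens_zero.
Qed.

Lemma tscaleDs a b s : tens_rel [seq ((a + b) *: p.1, p.2) | p <- s]
  ([seq (a *: p.1, p.2) | p <- s] ++ [seq (b *: p.1, p.2) | p <- s]).
Proof.
elim: s => [|[u v] s IHs] /=; first exact: tens_refl.
apply: (@tens_trans _ ([:: (a *: u, v); (b *: u, v)] ++
   ([seq (a *: p.1, p.2) | p <- s] ++ [seq (b *: p.1, p.2) | p <- s]))).
  rewrite -cat1s; apply: tens_cat => //.
  by rewrite scalerDl; exact: tens_addl.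
rewrite -[in X in tens_rel X _]cat1s -catA -[X in tens_rel _ X]cat1s.
apply: tens_cat; first exact: tens_refl.
rewrite catA -[X in tens_rel _ (_ ++ X)]cat1s [X in tens_rel _ X]catA.
apply: tens_cat; last exact: tens_refl.
exact: tens_catC.
Qed.

Definition topp (x : tensor) : tensor := tscale (-1) x.

Lemma taddN : left_inverse tzero topp tadd.
Proof.
elim/tensor_class_ind=> s; rewrite /topp tscale_class tadd_class.
apply/tclassP; apply: tens_trans (tscale0s s).
have {2}-> : s = [seq (1 *: p.1, p.2) | p <- s].
  by rewrite -[LHS]map_id; apply: eq_map => -[u v] /=; rewrite scale1r.
by rewrite -(addNr (1 : k)); apply: tens_sym; exact: tscaleDs.
Qed.

HB.instance Definition _ := GRing.isZmodule.Build tensor taddA taddC tadd0 taddN.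

Lemma tscaleA a b x : tscale a (tscale b x) = tscale (a * b) x.
Proof.
elim/tensor_class_ind: x => s; rewrite !tscale_class -map_comp; congr tclass.
by apply: eq_map => p /=; rewrite scalerA.
Qed.

Lemma tscale1 : left_id 1 tscale.
Proof.
elim/tensor_class_ind=> s; rewrite tscale_class; congr tclass.
by rewrite -[RHS]map_id; apply: eq_map => -[u v] /=; rewrite scale1r.
Qed.

Lemma tscaleDr : right_distributive tscale +%R.
Proof.
move=> a; elim/tensor_class_ind=> s; elim/tensor_class_ind=> t.
rewrite [_ + _]tadd_class !tscale_class map_cat.
by rewrite [RHS]tadd_class.
Qed.

Lemma tscaleDl x : {morph tscale^~ x : a b / a + b}.
Proof.
move=> a b; elim/tensor_class_ind: x => s; rewrite !tscale_class.
by rewrite [RHS]tadd_class; apply/tclassP; exact: tscaleDs.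
Qed.

HB.instance Definition _ :=
  GRing.Zmodule_isLmodule.Build k tensor tscaleA tscale1 tscaleDr tscaleDl.

Lemma tclassD s t : tclass s + tclass t = tclass (s ++ t).
Proof. exact: tadd_class. Qed.

Lemma tclassZ a s : a *: tclass s = tclass [seq (a *: p.1, p.2) | p <- s].
Proof. exact: tscale_class. Qed.

Lemma tpure_bilin : bilin tpure.
Proof.
split=> [v|u] a x y; rewrite /= /tpure tclassZ tclassD; apply/tclassP => /=.
  exact: tens_addl.
apply: tens_trans (tens_addr _ _ _) _.
apply: (@tens_cat [:: _] [:: _] [:: _]); last exact: tens_refl.
by apply: tens_sym; exact: tens_scale.
Qed.

Lemma tclassE s : tclass s = \sum_(p <- s) tpure p.1 p.2.
Proof.
elim: s => [|[u v] s IHs]; first by rewrite big_nil.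
by rewrite big_cons -IHs tclassD.
Qed.

Lemma tensorE (x : tensor) : x = \sum_(p <- repr x) tpure p.1 p.2.
Proof. by rewrite -tclassE tclassK. Qed.

Lemma tensor_ind (P : tensor -> Prop) :
  P 0 -> (forall x y, P x -> P y -> P (x + y)) ->
  (forall u v, P (tpure u v)) -> forall x, P x.
Proof.
move=> P0 PD Pp x; rewrite (tensorE x).
by elim: (repr x) => [|p s IHs]; rewrite ?big_nil // big_cons; exact: PD.
Qed.

(* [tlift f] sends the class of \sum_i u_i \ox v_i to \sum_i f u_i v_i; this  *)
(* is meaningful (independent of the representative) when f is bilinear, see  *)
(* [tliftE] and [tlift_linear].                                               *)
Definition tlift (W : lmodType k) (f : U -> V -> W) (x : tensor) : W :=
  \sum_(p <- repr x) f p.1 p.2.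

Section Lift.
Variables (W : lmodType k) (f : U -> V -> W).
Hypothesis f_bilin : bilin f.

Lemma bilinDl u u' v : f (u + u') v = f u v + f u' v.
Proof. by have := f_bilin.1 v 1 u u'; rewrite /= !scale1r. Qed.

Lemma bilinDr u v v' : f u (v + v') = f u v + f u v'.
Proof. by have := f_bilin.2 u 1 v v'; rewrite /= !scale1r. Qed.

Lemma bilin0l v : f 0 v = 0.
Proof. by apply: (addIr (f 0 v)); rewrite -bilinDl !add0r. Qed.

Lemma bilin0r u : f u 0 = 0.
Proof. by apply: (addIr (f u 0)); rewrite -bilinDr !add0r. Qed.

Lemma bilinZl a u v : f (a *: u) v = a *: f u v.
Proof. by have := f_bilin.1 v a u 0; rewrite /= !addr0 bilin0l addr0. Qed.

Lemma bilinZr a u v : f u (a *: v) = a *: f u v.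
Proof. by have := f_bilin.2 u a v 0; rewrite /= !addr0 bilin0r addr0. Qed.

Lemma tens_rel_bilin s t : tens_rel s t ->
  \sum_(p <- s) f p.1 p.2 = \sum_(p <- t) f p.1 p.2.
Proof.
elim=> {s t} //=.
- by move=> s t r _ -> _ ->.
- by move=> s s' t t' _ IHs _ IHt; rewrite !big_cat /= IHs IHt.
- by move=> s t; rewrite !big_cat /= addrC.
- by move=> u u' v; rewrite !big_cons !big_nil !addr0 bilinDl.
- by move=> u v v'; rewrite !big_cons !big_nil !addr0 bilinDr.
- by move=> a u v; rewrite !big_seq1 /= bilinZl bilinZr.
- by move=> v; rewrite big_seq1 big_nil /= bilin0l.
Qed.

Lemma tlift_class s : tlift f (tclass s) = \sum_(p <- s) f p.1 p.2.
Proof. by apply: tens_rel_bilin; exact: repr_tclass. Qed.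

Lemma tliftE u v : tlift f (tpure u v) = f u v.
Proof. by rewrite tlift_class big_seq1. Qed.

Lemma tlift_linear : linear (tlift f).
Proof.
move=> a; elim/tensor_class_ind=> s; elim/tensor_class_ind=> t.
rewrite tclassZ tclassD !tlift_class big_cat /=.
congr (_ + _); rewrite big_map scaler_sumr; apply: eq_bigr => p _ /=.
exact: bilinZl.
Qed.

End Lift.

Lemma tlift_param (T W : lmodType k) (F : T -> U -> V -> W) x :
  (forall u v, linear (fun z => F z u v)) -> linear (fun z => tlift (F z) x).
Proof.
move=> Flin a y z; rewrite /tlift scaler_sumr -big_split /=.
by apply: eq_bigr => p _; rewrite Flin.
Qed.

Lemma tlift_comp (W W' : lmodType k) (g : {linear W -> W'})
  (f : U -> V -> W) x : g (tlift f x) = tlift (fun u v => g (f u v)) x.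
Proof. by rewrite /tlift raddf_sum. Qed.

Lemma tensor_ext (W : lmodType k) (f g : tensor -> W) :
  linear f -> linear g -> (forall u v, f (tpure u v) = g (tpure u v)) ->
  f =1 g.
Proof.
move=> fL gL fg; pose fP := GRing.isLinear.Build _ _ _ _ f fL.
pose F : {linear tensor -> W} := HB.pack f fP.
pose gP := GRing.isLinear.Build _ _ _ _ g gL.
pose G : {linear tensor -> W} := HB.pack g gP.
move=> x; rewrite -[f x]/(F x) -[g x]/(G x).
elim/tensor_ind: x => [|x y IHx IHy|u v]; last exact: fg.
  by rewrite !linear0.
by rewrite !linearD IHx IHy.
Qed.

End TensorDef.

Notation "u \ox v" := (tpure u v) : ring_scope.

(* Sweedler-style notation: if t = \sum_i x_i \ox y_i, then                   *)
(* \tsum_(x, y <- t) E x y is \sum_i E x_i y_i, for E bilinear.               *)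
Notation "\tsum_ ( x , y <- t ) E" := (tlift (fun x y => E) t)
  (at level 36, E at level 36, x name, y name,
   format "'[' \tsum_ ( x ,  y  <-  t ) '/  '  E ']'") : ring_scope.

Section LinearLeftInverse.
Local Open Scope classical_set_scope.
Variables (k : fieldType) (U V : lmodType k) (f : {linear U -> V}).
Hypothesis f_inj : injective f.

Let P (W : set V) := (forall a x y, W x -> W y -> W (a *: x + y)) /\
  (forall u, W (f u) -> u = 0).

Let P_chain (F : set (set V)) : F `<=` P -> total_on F subset ->
  P (\bigcup_(X in F) X).
Proof.
move=> FP Ftot; split=> [a x y [X FX Xx] [Y FY Yy]|u [X FX]]; last first.
  exact: (FP X FX).2.
have [XY|YX] := Ftot X Y FX FY.
  by exists Y => //; apply: (FP Y FY).1 => //; exact: XY.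
by exists X => //; apply: (FP X FX).1 => //; exact: YX.
Qed.

Lemma linear_left_inverse : exists g : {linear V -> U}, cancel f g.
Proof.
have [W [[Wlin W0f] Wmax]] := Zorn_bigcup P_chain.
have W0 : W 0.
  apply: contrapT => NW0.
  have WE x : ~ W x.
    by move=> Wx; apply: NW0; have := Wlin (-1) x x Wx Wx; rewrite scaleN1r addNr.
  apply: (Wmax [set 0]).
    by split=> [x /WE //|/(_ 0 erefl)]; exact: NW0.
  split=> [a x y -> ->|u /=]; first by rewrite /= scaler0 addr0.
  by move=> fu0; apply: f_inj; rewrite fu0 linear0.
have WZ a x : W x -> W (a *: x).
  by move=> Wx; have := Wlin a x 0 Wx W0; rewrite addr0.
have WD x y : W x -> W y -> W (x + y).
  by move=> Wx Wy; have := Wlin 1 x y Wx Wy; rewrite scale1r.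
have Wdec v : exists u, W (v - f u).
  apply: contrapT => Nv.
  pose B : set V := [set x | exists2 c, W (x - c *: v) & True].
  apply: (Wmax B).
    split=> [x Wx|/(_ v)]; first by exists 0 => //; rewrite scale0r subr0.
    have Bv : B v by exists 1 => //; rewrite scale1r subrr.
    by move=> /(_ Bv) Wv; apply: Nv; exists 0; rewrite linear0 subr0.
  split=> [a x y [c Wx _] [d Wy _]|u [c Wu _]].
    exists (a * c + d) => //.
    have -> : a *: x + y - (a * c + d) *: v = a *: (x - c *: v) + (y - d *: v).
      by rewrite scalerDl scalerBr scalerA opprD addrACA.
    exact: Wlin.
  have [c0|c0] := eqVneq c 0; first by apply: W0f; rewrite c0 scale0r subr0 in Wu.
  exfalso; apply: Nv; exists (c^-1 *: u).
  have -> : v - f (c^-1 *: u) = (- c^-1) *: (f u - c *: v).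
    by rewrite linearZ /= scalerBr scalerA mulNr mulVf // !scaleNr scale1r opprK addrC.
  exact: WZ.
have [g gP] := choice Wdec.
have guniq v u : W (v - f u) -> g v = u.
  move=> Wu; apply/eqP; rewrite -subr_eq0; apply/eqP; apply: W0f.
  have -> : f (g v - u) = (-1) *: (v - f (g v)) + (v - f u).
    by rewrite linearB scaleN1r opprB addrA subrK.
  by apply: Wlin.
have g_lin : linear g.
  move=> a x y; apply: guniq.
  have -> : a *: x + y - f (a *: g x + g y) = a *: (x - f (g x)) + (y - f (g y)).
    by rewrite linearP opprD scalerBr addrACA.
  exact: Wlin.
pose gP' := GRing.isLinear.Build _ _ _ _ g g_lin.
exists (HB.pack g gP' : {linear V -> U}) => u /=.
by apply: guniq; rewrite subrr.
Qed.

End LinearLeftInverse.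

Lemma bilin_comp (k : fieldType) (U V U' V' W : lmodType k)
    (f : U' -> V' -> W) (g : U -> U') (h : V -> V') :
  bilin f -> linear g -> linear h -> bilin (fun u v => f (g u) (h v)).
Proof.
by move=> [fl fr] gL hL; split=> [v|u] a x y /=; rewrite ?gL ?hL ?fl ?fr.
Qed.

Lemma tpure_comp_bilin (k : fieldType) (U V U' V' : lmodType k)
    (g : U -> U') (h : V -> V') :
  linear g -> linear h -> bilin (fun u v => g u \ox h v).
Proof. by move=> gL hL; apply: bilin_comp gL hL; exact: tpure_bilin. Qed.

Section TensorMap.
Variables (k : fieldType) (U V U' V' : lmodType k).

Definition tmap (f : U -> U') (g : V -> V') (x : tensor U V) : tensor U' V' :=
  \tsum_(u, v <- x) (f u \ox g v).

Lemma tmapE (f : U -> U') (g : V -> V') u v : linear f -> linear g ->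
  tmap f g (u \ox v) = f u \ox g v.
Proof. by move=> fL gL; rewrite /tmap tliftE //; exact: tpure_comp_bilin. Qed.

Lemma tmap_linear (f : U -> U') (g : V -> V') : linear f -> linear g ->
  linear (tmap f g).
Proof. by move=> fL gL; apply: tlift_linear; exact: tpure_comp_bilin. Qed.

End TensorMap.

Lemma linear_id (k : fieldType) (U : lmodType k) : linear (@id U).
Proof. by []. Qed.

Lemma linear_comp (k : fieldType) (U V W : lmodType k) (f : V -> W)
  (g : U -> V) : linear f -> linear g -> linear (fun x => f (g x)).
Proof. by move=> fL gL a x y; rewrite gL fL. Qed.

Lemma linear_map0 (k : fieldType) (U V : lmodType k) (f : U -> V) :
  linear f -> f 0 = 0.
Proof.
by move=> fL; have := fL (-1) 0 0; rewrite scaler0 addr0 scaleN1r addNr.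
Qed.

Lemma linear_left_inverse_map (k : fieldType) (U V : lmodType k) (f : U -> V) :
  linear f -> injective f -> exists2 g : V -> U, linear g & cancel f g.
Proof.
move=> fL f_inj; pose fP := GRing.isLinear.Build _ _ _ _ f fL.
have [g fK] := @linear_left_inverse _ _ _ (HB.pack f fP : {linear U -> V}) f_inj.
by exists g; first exact: linearP.
Qed.

Lemma tmap_inj (k : fieldType) (U V U' V' : lmodType k)
    (f : U -> U') (g : V -> V') : linear f -> linear g ->
  injective f -> injective g -> injective (tmap f g).
Proof.
move=> fL gL /(linear_left_inverse_map fL)[f' f'L fK].
move=> /(linear_left_inverse_map gL)[g' g'L gK].
apply: (can_inj (g := tmap f' g')).
apply: (@tensor_ext _ _ _ _ (fun x => tmap f' g' (tmap f g x)) id).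
- by apply: linear_comp; exact: tmap_linear.
- exact: linear_id.
by move=> u v /=; rewrite !tmapE // fK gK.
Qed.

Section TensorAlgebra.
Variables (k : fieldType) (A B : algType k).

Definition tmul (x y : tensor A B) : tensor A B :=
  \tsum_(a, b <- x) \tsum_(a', b' <- y) ((a * a') \ox (b * b')).

Lemma mull_linear (C : algType k) (a : C) : linear (fun x : C => a * x).
Proof. by move=> c x y; rewrite mulrDr scalerAr. Qed.

Lemma mulr_linear (C : algType k) (a : C) : linear (fun x : C => x * a).
Proof. by move=> c x y; rewrite mulrDl scalerAl. Qed.

Let inner_bilin a b :
  bilin (fun a' b' => (a * a') \ox (b * b') : tensor A B).
Proof. by apply: tpure_comp_bilin; exact: mull_linear. Qed.

Let outer_bilin (y : tensor A B) :
  bilin (fun a b => \tsum_(a', b' <- y) ((a * a') \ox (b * b')) : tensor A B).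
Proof.
split=> [b|a] /=; apply: tlift_param => a' b' c x z /=.
  by rewrite mulr_linear (tpure_bilin _ _).1.
by rewrite mulr_linear (tpure_bilin _ _).2.
Qed.

Lemma tmul_bilin : bilin tmul.
Proof.
split=> [y|x] /=; first exact: tlift_linear.
by apply: tlift_param => a b; exact: tlift_linear.
Qed.

Lemma tmulE a b a' b' : tmul (a \ox b) (a' \ox b') = (a * a') \ox (b * b').
Proof. by rewrite /tmul !tliftE. Qed.

Lemma tmulDl : left_distributive tmul +%R.
Proof. by move=> x y z; rewrite (bilinDl tmul_bilin). Qed.

Lemma tmulDr : right_distributive tmul +%R.
Proof. by move=> x y z; rewrite (bilinDr tmul_bilin). Qed.

Lemma tmul0l x : tmul 0 x = 0. Proof. exact: bilin0l tmul_bilin _. Qed.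
Lemma tmul0r x : tmul x 0 = 0. Proof. exact: bilin0r tmul_bilin _. Qed.

Lemma tmulA : associative tmul.
Proof.
elim/tensor_ind=> [y z|x1 x2 h1 h2 y z|a b]; first by rewrite !tmul0l.
  by rewrite !tmulDl h1 h2.
elim/tensor_ind=> [z|y1 y2 h1 h2 z|a' b']; first by rewrite tmul0l tmul0r tmul0l.
  by rewrite tmulDl !tmulDr tmulDl h1 h2.
elim/tensor_ind=> [|z1 z2 h1 h2|a'' b'']; first by rewrite !tmul0r.
  by rewrite !tmulDr h1 h2.
by rewrite !tmulE !mulrA.
Qed.

Definition tone : tensor A B := 1 \ox 1.

Lemma tmul1x : left_id tone tmul.
Proof.
elim/tensor_ind=> [|x y hx hy|a b]; first by rewrite tmul0r.
  by rewrite tmulDr hx hy.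
by rewrite tmulE !mul1r.
Qed.

Lemma tmulx1 : right_id tone tmul.
Proof.
elim/tensor_ind=> [|x y hx hy|a b]; first by rewrite tmul0l.
  by rewrite tmulDl hx hy.
by rewrite tmulE !mulr1.
Qed.

Lemma unit_functional (C : algType k) : exists2 f : C -> k^o, linear f & f 1 = 1.
Proof.
have lin : linear (in_alg C : k^o -> C).
  by move=> a x y; rewrite rmorphD /= -scalerA.
have [g gL gK] := linear_left_inverse_map lin (@fmorph_inj _ _ (in_alg C)).
by exists g => //; have := gK 1; rewrite /= scale1r.
Qed.

Lemma tone_neq0 : tone != 0.
Proof.
have [f fL f1] := unit_functional A; have [g gL g1] := unit_functional B.
have FB : bilin (fun a b => f a * g b : k^o).
  split=> [b|a] c x y /=; first by rewrite fL mulrDl -scalerAl.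
  by rewrite gL mulrDr -scalerAr.
apply/eqP => one0; have := tliftE FB 1 1; rewrite f1 g1 mulr1 -/tone one0.
by rewrite (linear_map0 (tlift_linear FB)) => /esym /eqP; apply/negP; exact: oner_neq0.
Qed.

HB.instance Definition _ := GRing.Zmodule_isNzRing.Build (tensor A B)
  tmulA tmul1x tmulx1 tmulDl tmulDr tone_neq0.

Lemma tscaleAl (c : k) (x y : tensor A B) : c *: (x * y) = (c *: x) * y.
Proof. by rewrite [RHS](bilinZl tmul_bilin). Qed.

HB.instance Definition _ :=
  GRing.Lmodule_isLalgebra.Build k (tensor A B) tscaleAl.

Lemma tscaleAr (c : k) (x y : tensor A B) : c *: (x * y) = x * (c *: y).
Proof. by rewrite [RHS](bilinZr tmul_bilin). Qed.

HB.instance Definition _ :=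
  GRing.Lalgebra_isAlgebra.Build k (tensor A B) tscaleAr.

Lemma tensor_mulE (a a' : A) (b b' : B) :
  (a \ox b) * (a' \ox b') = (a * a') \ox (b * b').
Proof. exact: tmulE. Qed.

Lemma tensor_1E : 1 = 1 \ox 1 :> tensor A B. Proof. by []. Qed.

End TensorAlgebra.

Section TensorShuffle.
Variable k : fieldType.
Implicit Types U V W X : lmodType k.

Lemma bilin_ext U V U' V' W (f g : tensor U V -> tensor U' V' -> W) :
  bilin f -> bilin g ->
  (forall u v u' v', f (u \ox v) (u' \ox v') = g (u \ox v) (u' \ox v')) ->
  f =2 g.
Proof.
move=> [fl fr] [gl gr] fg x y.
apply: (@tensor_ext _ _ _ _ (f^~ y) (g^~ y)) => // u v.
exact: (@tensor_ext _ _ _ _ (f _) (g _)).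
Qed.

Lemma linear_bilin U V W W' (g : W -> W') (f : U -> V -> W) :
  linear g -> bilin f -> bilin (fun u v => g (f u v)).
Proof. by move=> gL [fl fr]; split=> [v|u] a x y /=; rewrite ?fl ?fr gL. Qed.

Definition tassoc U V W (t : tensor (tensor U V) W) : tensor U (tensor V W) :=
  \tsum_(x, w <- t) \tsum_(u, v <- x) (u \ox (v \ox w)).

Lemma tassoc_bilin1 U V W (w : W) :
  bilin (fun (u : U) (v : V) => u \ox (v \ox w)).
Proof.
apply: tpure_comp_bilin; first exact: linear_id.
exact: (tpure_bilin V W).1.
Qed.

Lemma tassoc_bilin2 U V W : bilin (fun (x : tensor U V) (w : W) =>
  \tsum_(u, v <- x) (u \ox (v \ox w))).
Proof.
split=> [w|x] /=; first by apply: tlift_linear; exact: tassoc_bilin1.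
apply: tlift_param => u v a w w' /=.
by rewrite (tpure_bilin _ _).2 (tpure_bilin _ _).2.
Qed.

Lemma tassoc_linear U V W : linear (@tassoc U V W).
Proof. by apply: tlift_linear; exact: tassoc_bilin2. Qed.

Lemma tassocE U V W (u : U) (v : V) (w : W) :
  tassoc ((u \ox v) \ox w) = u \ox (v \ox w).
Proof.
by rewrite /tassoc (tliftE (@tassoc_bilin2 U V W)) (tliftE (@tassoc_bilin1 _ _ _ w)).
Qed.

Definition tmid U V U' V' (s : tensor U V) (t : tensor U' V') :
    tensor (tensor U U') (tensor V V') :=
  \tsum_(u, v <- s) \tsum_(u', v' <- t) ((u \ox u') \ox (v \ox v')).

Definition tmidf U X U' X' W (F : X -> X' -> W) (s : tensor U X)
    (t : tensor U' X') : tensor (tensor U U') W :=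
  \tsum_(u, v <- s) \tsum_(u', v' <- t) ((u \ox u') \ox F v v').

Section Midf.
Variables (U X U' X' W : lmodType k) (F : X -> X' -> W).
Hypothesis FB : bilin F.

Let inner_bilin u v : bilin (fun (u' : U') (v' : X') => ((u : U) \ox u') \ox F v v').
Proof.
apply: tpure_comp_bilin; first exact: (tpure_bilin U U').2.
exact: FB.2.
Qed.

Let outer_bilin (t : tensor U' X') : bilin (fun (u : U) (v : X) =>
  \tsum_(u', v' <- t) ((u \ox u') \ox F v v')).
Proof.
split=> [v|u] /=; apply: tlift_param => u' v' a x y /=.
  by rewrite (tpure_bilin _ _).1 (tpure_bilin _ _).1.
by rewrite FB.1 (tpure_bilin _ _).2.
Qed.

Lemma tmidf_bilin : bilin (@tmidf U X U' X' W F).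
Proof.
split=> [y|x] /=; first exact: tlift_linear.
by apply: tlift_param => a b; exact: tlift_linear.
Qed.

Lemma tmidfE u v u' v' : @tmidf U X U' X' W F (u \ox v) (u' \ox v') =
  (u \ox u') \ox F v v'.
Proof. by rewrite /tmidf (tliftE (outer_bilin _)) (tliftE (inner_bilin _ _)). Qed.

End Midf.

Lemma tmid_bilin U V U' V' : bilin (@tmid U V U' V').
Proof. exact: (tmidf_bilin _ _ (tpure_bilin V V')). Qed.

Lemma tmidE U V U' V' (u : U) (v : V) (u' : U') (v' : V') :
  tmid (u \ox v) (u' \ox v') = (u \ox u') \ox (v \ox v').
Proof. exact: (tmidfE (tpure_bilin V V')). Qed.

End TensorShuffle.

HB.mixin Record isCoalgebra (k : fieldType) C of GRing.Lmodule k C := {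
  comul_subdef : C -> tensor C C;
  counit_subdef : C -> k;
  comul_linear_subproof : linear comul_subdef;
  counit_linear_subproof : scalar counit_subdef;
  comulA_subproof : forall x, tassoc (tmap comul_subdef id (comul_subdef x)) =
    tmap id comul_subdef (comul_subdef x);
  counitl_subproof :
    forall x, \tsum_(y, z <- comul_subdef x) (counit_subdef y *: z) = x;
  counitr_subproof :
    forall x, \tsum_(y, z <- comul_subdef x) (counit_subdef z *: y) = x
}.

#[short(type="coalgType")]
HB.structure Definition Coalgebra (k : fieldType) :=
  {C of GRing.Lmodule k C & isCoalgebra k C}.

(* [comul] is [comul_subdef] with a type stated on the bundled structure.      *)
Section CoalgebraTheory.
Variables (k : fieldType) (C : coalgType k).

Definition comul (x : C) : tensor C C := comul_subdef x.
Definition counit (x : C) : k := counit_subdef x.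

Lemma comul_linear : linear comul.
Proof. exact: comul_linear_subproof. Qed.

Lemma counit_linear : scalar counit.
Proof. exact: counit_linear_subproof. Qed.

Lemma comulA x : tassoc (tmap comul id (comul x)) = tmap id comul (comul x).
Proof. exact: comulA_subproof. Qed.

Lemma counitl x : \tsum_(y, z <- comul x) (counit y *: z) = x.
Proof. exact: counitl_subproof. Qed.

Lemma counitr x : \tsum_(y, z <- comul x) (counit z *: y) = x.
Proof. exact: counitr_subproof. Qed.

End CoalgebraTheory.

Arguments comul {k C} x.
Arguments counit {k C} x.

HB.mixin Record isBialgebra (k : fieldType) B
    of GRing.Algebra k B & Coalgebra k B := {
  comul1_subproof : comul (1 : B) = 1;
  comulM_subproof : forall x y : B, comul (x * y) = comul x * comul y;
  counit1_subproof : counit (1 : B) = 1;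
  counitM_subproof : forall x y : B, counit (x * y) = counit x * counit y
}.

#[short(type="bialgType")]
HB.structure Definition Bialgebra (k : fieldType) :=
  {B of GRing.Algebra k B & Coalgebra k B & isBialgebra k B}.

Section BialgebraTheory.
Variables (k : fieldType) (B : bialgType k).

Lemma comul1 : comul (1 : B) = 1.
Proof. exact: comul1_subproof. Qed.

Lemma comulM (x y : B) : comul (x * y) = comul x * comul y.
Proof. exact: comulM_subproof. Qed.

Lemma counit1 : counit (1 : B) = 1.
Proof. exact: counit1_subproof. Qed.

Lemma counitM (x y : B) : counit (x * y) = counit x * counit y.
Proof. exact: counitM_subproof. Qed.

End BialgebraTheory.

HB.mixin Record hasAntipode (k : fieldType) H of Bialgebra k H := {
  antip : H -> H;
  antip_linear : linear antip;
  antipl_subproof : forall x : H,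
    \tsum_(y, z <- comul x) (antip y * z) = (counit x)%:A;
  antipr_subproof : forall x : H,
    \tsum_(y, z <- comul x) (y * antip z) = (counit x)%:A
}.

#[short(type="hopfAlgType")]
HB.structure Definition HopfAlgebra (k : fieldType) :=
  {H of Bialgebra k H & hasAntipode k H}.

Section HopfTheory.
Variables (k : fieldType) (H : hopfAlgType k).

Lemma antipl (x : H) : \tsum_(y, z <- comul x) (antip y * z) = (counit x)%:A.
Proof. exact: antipl_subproof. Qed.

Lemma antipr (x : H) : \tsum_(y, z <- comul x) (y * antip z) = (counit x)%:A.
Proof. exact: antipr_subproof. Qed.

End HopfTheory.

Section TensorCoalgebra.
Variables (k : fieldType) (A B : coalgType k).

Definition tcomul (x : tensor A B) : tensor (tensor A B) (tensor A B) :=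
  \tsum_(a, b <- x) tmid (comul a) (comul b).

Definition tcounit (x : tensor A B) : k :=
  @tlift k A B k^o (fun a b => counit a * counit b) x.

Let tcomul_bilin : bilin (fun (a : A) (b : B) => tmid (comul a) (comul b)).
Proof.
by apply: bilin_comp; [exact: tmid_bilin|exact: comul_linear..].
Qed.

Let tcounit_bilin : bilin (fun (a : A) (b : B) => (counit a * counit b : k^o)).
Proof.
split=> [b|a] c x y /=; rewrite counit_linear.
  by rewrite mulrDl /= -mulrA.
by rewrite mulrDr /= mulrCA.
Qed.

Lemma tcomul_linear : linear tcomul.
Proof. exact: tlift_linear. Qed.

Lemma tcounit_linear : scalar tcounit.
Proof. exact: (tlift_linear tcounit_bilin). Qed.

Lemma tcomulE a b : tcomul (a \ox b) = tmid (comul a) (comul b).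
Proof. exact: tliftE. Qed.

Lemma tcounitE a b : tcounit (a \ox b) = counit a * counit b.
Proof. exact: (tliftE tcounit_bilin). Qed.

Let lid := linear_id.
Let cl := @comul_linear k.

Lemma tcomulA x :
  tassoc (tmap tcomul id (tcomul x)) = tmap id tcomul (tcomul x).
Proof.
move: x; apply: tensor_ext.
- apply: (linear_comp (@tassoc_linear _ _ _ _)).
  by apply: (linear_comp (tmap_linear tcomul_linear (@lid _ _))); exact: tcomul_linear.
- by apply: (linear_comp (tmap_linear (@lid _ _) tcomul_linear)); exact: tcomul_linear.
move=> a b; rewrite /= tcomulE.
have h1 : forall (s : tensor A A) (t : tensor B B), tassoc (tmap tcomul id (tmid s t)) =
  tmidf (@tmid k A A B B) (tassoc (tmap comul id s)) (tassoc (tmap comul id t)).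
  apply: bilin_ext.
  - have gL : linear (fun x : tensor (tensor A B) (tensor A B) =>
        tassoc (tmap tcomul id x)).
      apply: (linear_comp (@tassoc_linear _ _ _ _)).
      exact: tmap_linear tcomul_linear (@lid _ _).
    exact: (linear_bilin gL (@tmid_bilin _ _ _ _ _)).
  - apply: bilin_comp; first exact: (tmidf_bilin _ _ (@tmid_bilin _ _ _ _ _)).
      apply: (linear_comp (@tassoc_linear _ _ _ _)).
      exact: tmap_linear (@cl _) (@lid _ _).
    apply: (linear_comp (@tassoc_linear _ _ _ _)).
    exact: tmap_linear (@cl _) (@lid _ _).
  move=> a1 a2 b1 b2; rewrite tmidE.
  rewrite (tmapE _ _ tcomul_linear (@lid _ _)).
  rewrite !(tmapE _ _ (@cl _) (@lid _ _)) tcomulE.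
  move: (comul a1) (comul b1); apply: bilin_ext.
  - have gL : linear (fun x : tensor (tensor A B) (tensor A B) =>
        tassoc (x \ox (a2 \ox b2))).
      apply: (linear_comp (@tassoc_linear _ _ _ _)).
      exact: (tpure_bilin _ _).1.
    exact: (linear_bilin gL (@tmid_bilin _ _ _ _ _)).
  - apply: bilin_comp; first exact: (tmidf_bilin _ _ (@tmid_bilin _ _ _ _ _)).
      apply: (linear_comp (@tassoc_linear _ _ _ _)).
      exact: (tpure_bilin _ _).1.
    apply: (linear_comp (@tassoc_linear _ _ _ _)).
    exact: (tpure_bilin _ _).1.
  move=> u v u' v'; rewrite tmidE !tassocE tmidfE ?tmidE //.
  exact: tmid_bilin.
have h2 : forall (s : tensor A A) (t : tensor B B), tmap id tcomul (tmid s t) =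
  tmidf (@tmid k A A B B) (tmap id comul s) (tmap id comul t).
  apply: bilin_ext.
  - have gL := tmap_linear (@lid k (tensor A B)) tcomul_linear.
    exact: (linear_bilin gL (@tmid_bilin _ _ _ _ _)).
  - apply: bilin_comp; first exact: (tmidf_bilin _ _ (@tmid_bilin _ _ _ _ _)).
      exact: tmap_linear (@lid _ _) (@cl _).
    exact: tmap_linear (@lid _ _) (@cl _).
  move=> a1 a2 b1 b2; rewrite tmidE.
  rewrite (tmapE _ _ (@lid _ _) tcomul_linear).
  rewrite !(tmapE _ _ (@lid _ _) (@cl _)) tcomulE tmidfE //.
  exact: tmid_bilin.
by rewrite h1 h2 !comulA.
Qed.

Let cuL (C : coalgType k) : linear (counit : C -> k^o).
Proof. exact: counit_linear. Qed.

Lemma scale_bilin (C : lmodType k) : bilin (fun (a : k^o) (x : C) => a *: x).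
Proof.
split=> [x|a] c u v /=; first by rewrite scalerDl scalerA.
by rewrite scalerDr !scalerA mulrC.
Qed.

Lemma counitl_bilin (C : lmodType k) (e : C -> k) :
  scalar e -> bilin (fun y z : C => e y *: z).
Proof.
move=> eL; apply: (bilin_comp (@scale_bilin C) (eL : linear (e : C -> k^o))).
exact: lid.
Qed.

Lemma counitr_bilin (C : lmodType k) (e : C -> k) :
  scalar e -> bilin (fun y z : C => e z *: y).
Proof. by move=> eL; have [hl hr] := counitl_bilin eL; split=> x. Qed.

Lemma tcounitl x : \tsum_(y, z <- tcomul x) (tcounit y *: z) = x.
Proof.
have tB := counitl_bilin tcounit_linear.
have AB := counitl_bilin (@counit_linear k A).
have BB := counitl_bilin (@counit_linear k B).
move: x; apply: tensor_ext.
- by apply: (linear_comp (tlift_linear tB)); exact: tcomul_linear.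
- exact: lid.
move=> a b; rewrite /= tcomulE.
rewrite -[in RHS](counitl a) -[in RHS](counitl b).
move: (comul a) (comul b); apply: bilin_ext.
- by apply: (linear_bilin (tlift_linear tB)); exact: tmid_bilin.
- by apply: tpure_comp_bilin; exact: tlift_linear.
move=> a1 a2 b1 b2; rewrite tmidE !tliftE // tcounitE.
by rewrite (bilinZl (tpure_bilin _ _)) (bilinZr (tpure_bilin _ _)) scalerA.
Qed.

Lemma tcounitr x : \tsum_(y, z <- tcomul x) (tcounit z *: y) = x.
Proof.
have tB := counitr_bilin tcounit_linear.
have AB := counitr_bilin (@counit_linear k A).
have BB := counitr_bilin (@counit_linear k B).
move: x; apply: tensor_ext.
- by apply: (linear_comp (tlift_linear tB)); exact: tcomul_linear.
- exact: lid.
move=> a b; rewrite /= tcomulE.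
rewrite -[in RHS](counitr a) -[in RHS](counitr b).
move: (comul a) (comul b); apply: bilin_ext.
- by apply: (linear_bilin (tlift_linear tB)); exact: tmid_bilin.
- by apply: tpure_comp_bilin; exact: tlift_linear.
move=> a1 a2 b1 b2; rewrite tmidE !tliftE // tcounitE.
by rewrite (bilinZl (tpure_bilin _ _)) (bilinZr (tpure_bilin _ _)) scalerA.
Qed.

HB.instance Definition _ := isCoalgebra.Build k (tensor A B)
  tcomul_linear tcounit_linear tcomulA tcounitl tcounitr.

End TensorCoalgebra.

Lemma alg_mul_bilin (k : fieldType) (C : algType k) :
  bilin (fun x y : C => x * y).
Proof. by split=> [y|x]; [exact: mulr_linear|exact: mull_linear]. Qed.

Section TensorMultiplicative.
Variables (k : fieldType) (A B : algType k).

Lemma tmidM (s s' : tensor A A) (t t' : tensor B B) :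
  tmid (s * s') (t * t') = tmid s t * tmid s' t'.
Proof.
move: s t; apply: bilin_ext.
- by apply: (bilin_comp (@tmid_bilin _ _ _ _ _)); exact: mulr_linear.
- exact: (linear_bilin (mulr_linear _) (@tmid_bilin _ _ _ _ _)).
move=> a1 a2 b1 b2; move: s' t'; apply: bilin_ext.
- by apply: (bilin_comp (@tmid_bilin _ _ _ _ _)); exact: mull_linear.
- exact: (linear_bilin (mull_linear _) (@tmid_bilin _ _ _ _ _)).
move=> a1' a2' b1' b2'.
by rewrite !tensor_mulE !tmidE !tensor_mulE.
Qed.

Variables (dA : A -> tensor A A) (dB : B -> tensor B B).
Variables (eA : A -> k) (eB : B -> k).
Hypotheses (dAL : linear dA) (dBL : linear dB).
Hypotheses (dAM : {morph dA : x y / x * y}) (dBM : {morph dB : x y / x * y}).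
Hypotheses (eAL : scalar eA) (eBL : scalar eB).
Hypotheses (eAM : {morph eA : x y / x * y}) (eBM : {morph eB : x y / x * y}).

Let D (x : tensor A B) := \tsum_(a, b <- x) tmid (dA a) (dB b).
Let E (x : tensor A B) : k := @tlift k A B k^o (fun a b => eA a * eB b) x.

Let D_bilin : bilin (fun a b => tmid (dA a) (dB b)).
Proof. exact: (bilin_comp (@tmid_bilin _ _ _ _ _)). Qed.

Let E_bilin : bilin (fun a b => (eA a * eB b : k^o)).
Proof.
split=> [b|a] c x y /=; first by rewrite eAL mulrDl /= -mulrA.
by rewrite eBL mulrDr /= mulrCA.
Qed.

Lemma tmid_morph (x y : tensor A B) : D (x * y) = D x * D y.
Proof.
have DL : linear D by exact: tlift_linear.
move: x y; apply: bilin_ext.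
- exact: (linear_bilin DL (@alg_mul_bilin _ _)).
- exact: (bilin_comp (@alg_mul_bilin _ _) DL DL).
by move=> a b a' b'; rewrite tensor_mulE /D !tliftE // dAM dBM tmidM.
Qed.

Lemma tmul_morph (x y : tensor A B) : E (x * y) = E x * E y.
Proof.
have EL : linear (E : _ -> k^o) by exact: (tlift_linear E_bilin).
move: x y; apply: (@bilin_ext k A B A B k^o).
- exact: (linear_bilin EL (@alg_mul_bilin _ _)).
- exact: (bilin_comp (@alg_mul_bilin k k^o) EL EL).
move=> a b a' b'; rewrite tensor_mulE /E !(tliftE E_bilin) eAM eBM.
exact: mulrACA.
Qed.

End TensorMultiplicative.

Section TensorBialgebra.
Variables (k : fieldType) (A B : bialgType k).

Lemma tensor_comulE (a : A) (b : B) :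
  comul (a \ox b) = tmid (comul a) (comul b).
Proof. exact: tcomulE. Qed.

Lemma tensor_counitE (a : A) (b : B) : counit (a \ox b) = counit a * counit b.
Proof. exact: tcounitE. Qed.

Lemma tcomul1 : comul (1 : tensor A B) = 1.
Proof. by rewrite tensor_1E tensor_comulE !comul1 !tensor_1E tmidE. Qed.

Lemma tcomulM (x y : tensor A B) : comul (x * y) = comul x * comul y.
Proof.
(* The two sides reach the module structure of [tensor A B] along different   *)
(* inheritance paths: the kernel identifies them much faster than unification.*)
exact_no_check (@tmid_morph k A B comul comul (@comul_linear k A)
  (@comul_linear k B) (@comulM k A) (@comulM k B) x y).
Qed.

Lemma tcounit1 : counit (1 : tensor A B) = 1.
Proof. by rewrite tensor_1E tensor_counitE !counit1 mulr1. Qed.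

Lemma tcounitM (x y : tensor A B) : counit (x * y) = counit x * counit y.
Proof.
exact: (@tmul_morph k A B counit counit (@counit_linear k A)
  (@counit_linear k B) (@counitM k A) (@counitM k B) x y).
Qed.

HB.instance Definition _ := isBialgebra.Build k (tensor A B)
  tcomul1 tcomulM tcounit1 tcounitM.

End TensorBialgebra.

Section TensorHopf.
Variables (k : fieldType) (A B : hopfAlgType k).

Definition tantip : tensor A B -> tensor A B := tmap antip antip.

Lemma tantip_linear : linear tantip.
Proof. by apply: tmap_linear; exact: antip_linear. Qed.

Lemma tantipE a b : tantip (a \ox b) = antip a \ox antip b.
Proof. by apply: tmapE; exact: antip_linear. Qed.

Lemma antip_mul_bilin (C : algType k) (S : C -> C) : linear S ->
  bilin (fun y z : C => S y * z).
Proof. by move=> SL; apply: (bilin_comp (@alg_mul_bilin _ C) SL). Qed.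

Lemma mul_antip_bilin (C : algType k) (S : C -> C) : linear S ->
  bilin (fun y z : C => y * S z).
Proof. by move=> SL; apply: (bilin_comp (@alg_mul_bilin _ C) _ SL). Qed.

Let tensor_algE (a : A) (b : B) : (counit a)%:A \ox (counit b)%:A =
  (counit (a \ox b))%:A :> tensor A B.
Proof.
rewrite (bilinZl (tpure_bilin _ _)) (bilinZr (tpure_bilin _ _)) scalerA.
by rewrite tensor_counitE.
Qed.

Lemma tantipl (x : tensor A B) :
  \tsum_(y, z <- comul x) (tantip y * z) = (counit x)%:A.
Proof.
have tB := antip_mul_bilin tantip_linear.
have AB := antip_mul_bilin (@antip_linear k A).
have BB := antip_mul_bilin (@antip_linear k B).
move: x; apply: tensor_ext.
- by apply: (linear_comp (tlift_linear tB)); exact: comul_linear.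
- by move=> a x y; rewrite counit_linear scalerDl scalerA.
move=> a b; rewrite /= tensor_comulE -tensor_algE -!antipl.
move: (comul a) (comul b); apply: bilin_ext.
- by apply: (linear_bilin (tlift_linear tB)); exact: tmid_bilin.
- by apply: tpure_comp_bilin; exact: tlift_linear.
by move=> a1 a2 b1 b2; rewrite tmidE !tliftE // tantipE tensor_mulE.
Qed.

Lemma tantipr (x : tensor A B) :
  \tsum_(y, z <- comul x) (y * tantip z) = (counit x)%:A.
Proof.
have tB := mul_antip_bilin tantip_linear.
have AB := mul_antip_bilin (@antip_linear k A).
have BB := mul_antip_bilin (@antip_linear k B).
move: x; apply: tensor_ext.
- by apply: (linear_comp (tlift_linear tB)); exact: comul_linear.
- by move=> a x y; rewrite counit_linear scalerDl scalerA.
move=> a b; rewrite /= tensor_comulE -tensor_algE -!antipr.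
move: (comul a) (comul b); apply: bilin_ext.
- by apply: (linear_bilin (tlift_linear tB)); exact: tmid_bilin.
- by apply: tpure_comp_bilin; exact: tlift_linear.
by move=> a1 a2 b1 b2; rewrite tmidE !tliftE // tantipE tensor_mulE.
Qed.

HB.instance Definition _ := hasAntipode.Build k (tensor A B)
  tantip_linear tantipl tantipr.

End TensorHopf.

(* t belongs to (the image in H \ox H of) A \ox A *)
Definition in_tensor_square (k : fieldType) (H : lmodType k) (A : {pred H})
    (t : tensor H H) : Prop :=
  exists2 s : seq (H * H), {in s, forall p, (p.1 \in A) && (p.2 \in A)} &
    t = \sum_(p <- s) p.1 \ox p.2.

HB.mixin Record isHopfSubalg (k : fieldType) (H : hopfAlgType k)
    (A : {pred H}) := {
  comul_closed : {in A, forall x : H, in_tensor_square A (comul x)};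
  antip_closed : {in A, forall x : H, antip x \in A}
}.

#[short(type="hopfSubalg")]
HB.structure Definition HopfSubalg (k : fieldType) (H : hopfAlgType k) :=
  {A of @GRing.SubalgClosed k H A & isHopfSubalg k H A}.

Definition hsub (k : fieldType) (H : hopfAlgType k) (A : hopfSubalg H) :=
  {x : H | x \in A}.

Section HSub.
Variables (k : fieldType) (H : hopfAlgType k) (A : hopfSubalg H).

HB.instance Definition _ := SubChoice.on (hsub A).
HB.instance Definition _ := [SubChoice_isSubAlgebra of hsub A by <:].

Definition hval (x : hsub A) : H := val x.

Lemma hval_inj : injective hval. Proof. exact: val_inj. Qed.

Lemma hval_linear : linear hval.
Proof. exact: (linearP (\val : {linear hsub A -> H})). Qed.

HB.instance Definition _ := GRing.isLinear.Build k (hsub A) H *:%R hval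
  hval_linear.

Lemma tmap_hval_inj : injective (tmap hval hval).
Proof. exact: tmap_inj hval_linear hval_linear hval_inj hval_inj. Qed.

Lemma hval_comul_ex (x : hsub A) :
  exists t : tensor (hsub A) (hsub A), tmap hval hval t = comul (hval x).
Proof.
have [s sA ->] := comul_closed _ (valP x).
elim: s sA => [_|p s IHs sA].
  exists 0; rewrite big_nil.
  exact: linear_map0 (tmap_linear hval_linear hval_linear).
have [|t tE] := IHs; first by move=> q qs; apply: sA; rewrite inE qs orbT.
have /andP[pA1 pA2] := sA p (mem_head _ _).
exists ((Sub p.1 pA1 : hsub A) \ox (Sub p.2 pA2 : hsub A) + t).
rewrite -[_ \ox _]scale1r tmap_linear ?scale1r; try exact: hval_linear.
rewrite tmapE; try exact: hval_linear.
by rewrite big_cons tE /hval !SubK.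
Qed.

(* The unique t with (i \ox i) t = comul (i x), i being the inclusion; it is  *)
(* unique by [tmap_hval_inj].                                                 *)
Definition hcomul (x : hsub A) : tensor (hsub A) (hsub A) :=
  sval (cid (hval_comul_ex x)).

Definition hcounit (x : hsub A) : k := counit (hval x).

Definition hantip (x : hsub A) : hsub A := Sub (antip (hval x)) (antip_closed _ (valP x)).

Lemma hcomulE (x : hsub A) : tmap hval hval (hcomul x) = comul (hval x).
Proof. by rewrite /hcomul; case: cid. Qed.

Lemma hantipE (x : hsub A) : hval (hantip x) = antip (hval x).
Proof. by rewrite /hval SubK. Qed.

Let hvL := hval_linear.

Lemma hcomul_linear : linear hcomul.
Proof.
move=> a x y; apply: tmap_hval_inj.
by rewrite (tmap_linear hvL hvL) !hcomulE hvL comul_linear.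
Qed.

Lemma hcounit_linear : scalar hcounit.
Proof. by move=> a x y; rewrite /hcounit hvL counit_linear. Qed.

Lemma hantip_linear : linear hantip.
Proof.
by move=> a x y; apply: hval_inj; rewrite hvL !hantipE hvL antip_linear.
Qed.

Lemma tlift_hval (W : lmodType k) (f : H -> H -> W) t : bilin f ->
  tlift f (tmap hval hval t) = \tsum_(x, y <- t) f (hval x) (hval y).
Proof.
move=> fB; move: t; apply: tensor_ext => [||x y].
- by apply: (linear_comp (tlift_linear fB)); exact: tmap_linear.
- by apply: tlift_linear; exact: bilin_comp fB hvL hvL.
rewrite tmapE // tliftE // tliftE //; exact: bilin_comp fB hvL hvL.
Qed.

Let hid := @linear_id k.
Let cL := @comul_linear k H.
Let tvL := tmap_linear hvL hvL.

Lemma tassoc_nat (t : tensor (tensor (hsub A) (hsub A)) (hsub A)) :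
  tmap hval (tmap hval hval) (tassoc t) =
  tassoc (tmap (tmap hval hval) hval t).
Proof.
move: t; apply: tensor_ext.
- apply: (linear_comp (tmap_linear hvL tvL)); exact: tassoc_linear.
- apply: (linear_comp (@tassoc_linear _ _ _ _)); exact: tmap_linear.
move=> x c; rewrite tmapE //; move: x; apply: tensor_ext.
- apply: (linear_comp (tmap_linear hvL tvL)).
  by apply: (linear_comp (@tassoc_linear _ _ _ _)); exact: (tpure_bilin _ _).1.
- apply: (linear_comp (@tassoc_linear _ _ _ _)).
  exact: (linear_comp ((tpure_bilin (tensor H H) H).1 (hval c)) tvL).
by move=> a b; rewrite tassocE !tmapE // tassocE.
Qed.

Lemma hcomulA x : tassoc (tmap hcomul id (hcomul x)) = tmap id hcomul (hcomul x).
Proof.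
have inj : injective (tmap hval (tmap hval hval : tensor (hsub A) (hsub A) -> _)).
  exact: tmap_inj hvL tvL hval_inj tmap_hval_inj.
apply: inj; rewrite tassoc_nat.
have -> t : tmap (tmap hval hval) hval (tmap hcomul id t) =
    tmap comul id (tmap hval hval t).
  move: t; apply: tensor_ext.
  - by apply: (linear_comp (tmap_linear tvL hvL)); apply: tmap_linear => //; exact: hcomul_linear.
  - by apply: (linear_comp (tmap_linear cL (@hid _))).
  by move=> a b; rewrite !tmapE ?hcomulE //; exact: hcomul_linear.
have -> t : tmap hval (tmap hval hval) (tmap id hcomul t) =
    tmap id comul (tmap hval hval t).
  move: t; apply: tensor_ext.
  - by apply: (linear_comp (tmap_linear hvL tvL)); apply: tmap_linear => //; exact: hcomul_linear.
  - by apply: (linear_comp (tmap_linear (@hid _) cL)).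
  by move=> a b; rewrite !tmapE ?hcomulE //; exact: hcomul_linear.
by rewrite hcomulE comulA.
Qed.

Lemma hval_tlift (f : H -> H -> H) (g : hsub A -> hsub A -> hsub A) x :
  bilin f -> (forall y z, hval (g y z) = f (hval y) (hval z)) ->
  hval (tlift g (hcomul x)) = tlift f (comul (hval x)).
Proof.
move=> fB fg; rewrite -hcomulE tlift_hval // tlift_comp.
by rewrite /tlift; apply: eq_bigr => p _; exact: fg.
Qed.

Lemma hcounitl x : \tsum_(y, z <- hcomul x) (hcounit y *: z) = x.
Proof.
apply: hval_inj; rewrite (hval_tlift (f := fun y z => counit y *: z)).
- exact: counitl.
- exact: counitl_bilin (@counit_linear k H).
by move=> y z; rewrite linearZ.
Qed.

Lemma hcounitr x : \tsum_(y, z <- hcomul x) (hcounit z *: y) = x.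
Proof.
apply: hval_inj; rewrite (hval_tlift (f := fun y z => counit z *: y)).
- exact: counitr.
- exact: counitr_bilin (@counit_linear k H).
by move=> y z; rewrite linearZ.
Qed.

HB.instance Definition _ := isCoalgebra.Build k (hsub A)
  hcomul_linear hcounit_linear hcomulA hcounitl hcounitr.

Lemma hval_comul (x : hsub A) : comul (hval x) = tmap hval hval (comul x).
Proof. by rewrite -hcomulE. Qed.

Lemma hval_counit (x : hsub A) : counit (hval x) = counit x.
Proof. by []. Qed.

Lemma hvalM (x y : hsub A) : hval (x * y) = hval x * hval y.
Proof. by rewrite /hval rmorphM. Qed.

Lemma hval1 : hval 1 = 1.
Proof. by rewrite /hval rmorph1. Qed.

Lemma tmap_hvalM (s t : tensor (hsub A) (hsub A)) :
  tmap hval hval (s * t) = tmap hval hval s * tmap hval hval t.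
Proof.
move: s t; apply: bilin_ext.
- exact: (linear_bilin tvL (@alg_mul_bilin k (tensor (hsub A) (hsub A)))).
- exact: (bilin_comp (@alg_mul_bilin k (tensor H H)) tvL tvL).
by move=> a b a' b'; rewrite tensor_mulE !tmapE // tensor_mulE !hvalM.
Qed.

Lemma hcomul1 : comul (1 : hsub A) = 1.
Proof.
apply: tmap_hval_inj; rewrite -hval_comul hval1 comul1 !tensor_1E.
by rewrite tmapE // !hval1.
Qed.

Lemma hcomulM (x y : hsub A) : comul (x * y) = comul x * comul y.
Proof.
apply: tmap_hval_inj; rewrite -hval_comul hvalM comulM tmap_hvalM.
by rewrite -!hval_comul.
Qed.

Lemma hcounit1 : counit (1 : hsub A) = 1.
Proof. by rewrite -hval_counit hval1 counit1. Qed.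

Lemma hcounitM (x y : hsub A) : counit (x * y) = counit x * counit y.
Proof. by rewrite -!hval_counit hvalM counitM. Qed.

HB.instance Definition _ := isBialgebra.Build k (hsub A)
  hcomul1 hcomulM hcounit1 hcounitM.

Lemma hval_algE (a : k) : hval a%:A = a%:A.
Proof. by rewrite linearZ /= hval1. Qed.

Lemma hantipl (x : hsub A) :
  \tsum_(y, z <- comul x) (hantip y * z) = (counit x)%:A.
Proof.
apply: hval_inj; rewrite (hval_tlift (f := fun y z => antip y * z)).
- by rewrite antipl hval_algE.
- exact: antip_mul_bilin antip_linear.
by move=> y z; rewrite hvalM hantipE.
Qed.

Lemma hantipr (x : hsub A) :
  \tsum_(y, z <- comul x) (y * hantip z) = (counit x)%:A.
Proof.
apply: hval_inj; rewrite (hval_tlift (f := fun y z => y * antip z)).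
- by rewrite antipr hval_algE.
- exact: mul_antip_bilin antip_linear.
by move=> y z; rewrite hvalM hantipE.
Qed.

HB.instance Definition _ := hasAntipode.Build k (hsub A)
  hantip_linear hantipl hantipr.

End HSub.

Definition normal_hopf_subalg (k : fieldType) (H : hopfAlgType k)
    (A : hopfSubalg H) : Prop :=
  forall h a : H, a \in A ->
    (\tsum_(h1, h2 <- comul h) (h1 * a * antip h2) \in A) /\
    (\tsum_(h1, h2 <- comul h) (antip h1 * a * h2) \in A).

Definition mult_map (k : fieldType) (H : hopfAlgType k) (A L : hopfSubalg H)
    (t : tensor (hsub A) (hsub L)) : H :=
  \tsum_(a, l <- t) (hval a * hval l).

Arguments mult_map {k H} A L t.

Definition factorization (k : fieldType) (H : hopfAlgType k)
    (A L : hopfSubalg H) : Prop :=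
  bijective (mult_map A L).

Record hopf_morphism (k : fieldType) (G H : hopfAlgType k) (f : G -> H) :
    Prop := HopfMorphism {
  hopf_morphism_linear : linear f;
  hopf_morphism1 : f 1 = 1;
  hopf_morphismM : {morph f : x y / x * y};
  hopf_morphism_comul : forall x, comul (f x) = tmap f f (comul x);
  hopf_morphism_counit : forall x, counit (f x) = counit x;
  hopf_morphism_antip : forall x, antip (f x) = f (antip x)
}.

Definition hopf_isomorphism (k : fieldType) (G H : hopfAlgType k)
    (f : G -> H) : Prop := hopf_morphism f /\ bijective f.

(* Main.v *)
(* An element x of both A and L is the image of x \ox 1 and of 1 \ox x, so    *)
(* injectivity of the multiplication map forces A and L to meet in k.         *)
(* In the convolution algebra of linear maps from A \ox L to H, the map       *)
(* r : a \ox l |-> S(a) S(l) is left inverse to q : a \ox l |-> l a, while    *)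
(* normality of A and L puts the values of p * r, with p : a \ox l |-> a l,   *)
(* in that intersection, so that p * r is the unit. Hence p = q: A and L      *)
(* commute elementwise, and multiplication is a morphism of Hopf algebras.    *)

Require Import Defs.
From HB Require Import structures.
From mathcomp Require Import all_boot all_order all_algebra.
Import GRing.Theory.
Local Open Scope ring_scope.

Set Implicit Arguments.
Unset Strict Implicit.
Unset Printing Implicit Defensive.

(** The heart is elementwise commutation, [factorization_commute]. Normality makes a1 l1 S(a2) S(l2)
    a product inside A and also inside L, and an element of both is a scalar by [mem_both_scalar];
    applying the counit identifies that scalar as e(a)e(l). So a ⊗ l |-> S(a)S(l) is a right
    convolution inverse of [mult_map] ([conv_mult_opmult_inv]) and a left one of [opmult_map]
    ([conv_opmult_inv]). Uniqueness of inverses, [conv_inv_uniq], gives al = la. Commutation makes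
    [mult_map] multiplicative, and a bialgebra map between Hopf algebras respects antipodes
    ([bialg_morphism_antip]). *)

(** * Sweedler sums under linear maps *)

Lemma linear_mapZ (k : fieldType) (U V : lmodType k) (f : U -> V) a x :
  linear f -> f (a *: x) = a *: f x.
Proof. by move=> fL; rewrite -[a *: x]addr0 fL (linear_map0 fL) addr0. Qed.

Lemma linear_map_sum (k : fieldType) (U V : lmodType k) (f : U -> V) (I : Type)
    (r : seq I) (F : I -> U) :
  linear f -> f (\sum_(i <- r) F i) = \sum_(i <- r) f (F i).
Proof.
move=> fL; elim: r => [|i r IHr]; first by rewrite !big_nil (linear_map0 fL).
by rewrite !big_cons -IHr -[F i]scale1r fL !scale1r.
Qed.

Lemma tlift_tmap (k : fieldType) (U V U' V' W : lmodType k) (f : U -> U')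
    (g : V -> V') (F : U' -> V' -> W) (t : tensor U V) :
  bilin F -> tlift F (tmap f g t) = \tsum_(u, v <- t) F (f u) (g v).
Proof.
move=> FB; rewrite -[tmap f g t]/(\sum_(p <- repr t) (f p.1 \ox g p.2)).
rewrite (linear_map_sum _ _ (tlift_linear FB)).
by apply: eq_bigr => p _; exact: tliftE.
Qed.

(** The coproduct of a ⊗ l is a [tmid], so this turns convolution products on A ⊗ L into double
    Sweedler sums. *)
Lemma tlift_tmid (k : fieldType) (U V U' V' W : lmodType k)
    (F : tensor U U' -> tensor V V' -> W) (s : tensor U V) (t : tensor U' V') :
  bilin F -> tlift F (tmid s t) =
    \tsum_(u, v <- s) \tsum_(u', v' <- t) F (u \ox u') (v \ox v').
Proof.
move=> FB; have FL := tlift_linear FB.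
rewrite -[tmid s t]/(\sum_(p <- repr s) \sum_(q <- repr t)
  ((p.1 \ox q.1) \ox (p.2 \ox q.2))).
rewrite (linear_map_sum _ _ FL); apply: eq_bigr => p _.
rewrite (linear_map_sum _ _ FL); apply: eq_bigr => q _; exact: tliftE.
Qed.

Lemma tlift_exchange (k : fieldType) (U V U' V' W : lmodType k)
    (F : U -> V -> U' -> V' -> W) (s : tensor U V) (t : tensor U' V') :
  \tsum_(u, v <- s) \tsum_(u', v' <- t) F u v u' v' =
  \tsum_(u', v' <- t) \tsum_(u, v <- s) F u v u' v'.
Proof. exact: exchange_big. Qed.

Lemma tlift_eq (k : fieldType) (U V W : lmodType k) (F G : U -> V -> W)
    (t : tensor U V) : (forall u v, F u v = G u v) -> tlift F t = tlift G t.
Proof. by move=> FG; apply: eq_bigr => p _. Qed.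

Lemma mul_bilin (k : fieldType) (U V : lmodType k) (B : algType k)
    (f : U -> B) (g : V -> B) : linear f -> linear g ->
  bilin (fun u v => f u * g v).
Proof. exact: (bilin_comp (@alg_mul_bilin k B)). Qed.

(** * The convolution algebra Hom(C, B) *)

Section Convolution.
Variables (k : fieldType) (C : coalgType k) (B : algType k).
Implicit Types f g h : C -> B.

Definition conv f g (x : C) : B := \tsum_(y, z <- comul x) (f y * g z).

Definition conv1 (x : C) : B := (counit x)%:A.

Lemma conv1_linear : linear conv1.
Proof. by move=> a x y; rewrite /conv1 counit_linear scalerDl scalerA. Qed.

Lemma conv_linear f g : linear f -> linear g -> linear (conv f g).
Proof.
move=> fL gL; apply: (linear_comp (tlift_linear (mul_bilin fL gL))).
exact: comul_linear.
Qed.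

Lemma convA f g h : linear f -> linear g -> linear h ->
  conv (conv f g) h =1 conv f (conv g h).
Proof.
move=> fL gL hL x.
have fgB := mul_bilin fL gL; have ghB := mul_bilin gL hL.
have lB := mul_bilin (tlift_linear fgB) hL.
have rB := mul_bilin fL (tlift_linear ghB).
(* By coassociativity both sides are linear functions of the same tensor, the right one through
   [tassoc]. They agree on every tensor, so pure ones suffice. *)
rewrite /conv -(tlift_tmap comul id _ lB) -(tlift_tmap id comul _ rB) -comulA.
move: (tmap comul id (comul x)); apply: tensor_ext.
- exact: tlift_linear.
- by apply: (linear_comp (tlift_linear rB)); exact: tassoc_linear.
move=> w c; rewrite tliftE //; move: w; apply: tensor_ext.
- exact: (linear_comp (@mulr_linear k B _) (tlift_linear fgB)).
- apply: (linear_comp (tlift_linear rB)).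
  apply: (linear_comp (@tassoc_linear _ _ _ _)).
  exact: (tpure_bilin _ _).1.
by move=> a b; rewrite tassocE !tliftE // mulrA.
Qed.

Lemma conv1f f : linear f -> conv conv1 f =1 f.
Proof.
move=> fL x; rewrite -[RHS]/(f x) -[in RHS](counitl x) /tlift.
rewrite (linear_map_sum _ _ fL); apply: eq_bigr => p _.
by rewrite /conv1 -scalerAl mul1r (linear_mapZ _ _ fL).
Qed.

Lemma convf1 f : linear f -> conv f conv1 =1 f.
Proof.
move=> fL x; rewrite -[RHS]/(f x) -[in RHS](counitr x) /tlift.
rewrite (linear_map_sum _ _ fL); apply: eq_bigr => p _.
by rewrite /conv1 -scalerAr mulr1 (linear_mapZ _ _ fL).
Qed.

(** In a monoid a left and a right inverse of the same element coincide. It serves twice: for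
    antipodes under bialgebra maps, and for al = la. *)
Lemma conv_inv_uniq f g h : linear f -> linear g -> linear h ->
  conv f g =1 conv1 -> conv g h =1 conv1 -> f =1 h.
Proof.
move=> fL gL hL fg gh x; rewrite -(convf1 fL) -(conv1f hL).
transitivity (conv f (conv g h) x); first by apply: tlift_eq => u v; rewrite gh.
by rewrite -convA //; apply: tlift_eq => u v; rewrite fg.
Qed.

End Convolution.

Arguments conv1 {k C B} x.

(** * Antipode and counit identities *)

(** S f is a left and f S a right convolution inverse of f. *)
Lemma bialg_morphism_antip (k : fieldType) (G H : hopfAlgType k) (f : G -> H) :
  linear f -> f 1 = 1 -> {morph f : x y / x * y} ->
  (forall x, comul (f x) = tmap f f (comul x)) ->
  (forall x, counit (f x) = counit x) ->
  forall x, antip (f x) = f (antip x).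
Proof.
move=> fL f1 fM fcomul fcounit; apply: (conv_inv_uniq _ fL).
- exact: linear_comp (@antip_linear k H) fL.
- exact: linear_comp fL (@antip_linear k G).
- move=> x; rewrite /conv1 -fcounit -antipl fcomul.
  by rewrite tlift_tmap //; exact: antip_mul_bilin (@antip_linear k H).
move=> x; rewrite /conv1.
have -> : (counit x)%:A = f (counit x)%:A.
  by rewrite (linear_mapZ _ _ fL) f1.
rewrite -antipr /conv /tlift (linear_map_sum _ _ fL).
by apply: eq_bigr => p _; rewrite fM.
Qed.

(** Apply the counit e to S(x1) x2 = e(x)1: the left side becomes e(S(x1 e(x2))) = e(S(x)). *)
Lemma counit_antip (k : fieldType) (H : hopfAlgType k) (x : H) :
  counit (antip x) = counit x.
Proof.
have eL : linear (counit : H -> k^o) by exact: counit_linear.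
have SL := @antip_linear k H.
rewrite -[in LHS](counitr x) /tlift.
rewrite (linear_map_sum _ _ SL) (linear_map_sum _ _ eL).
have := congr1 (counit : H -> k^o) (antipl x).
rewrite /tlift (linear_map_sum _ _ eL) (linear_mapZ _ _ eL) counit1.
rewrite [_ *: _]mulr1 => <-; apply: eq_bigr => p _.
rewrite counitM (linear_mapZ _ _ SL) (linear_mapZ _ _ eL).
exact: mulrC.
Qed.

Lemma sum_counit (k : fieldType) (C : coalgType k) (x : C) :
  \sum_(p <- repr (comul x)) counit p.1 * counit p.2 = counit x.
Proof.
have eL : linear (counit : C -> k^o) by exact: counit_linear.
rewrite -[in RHS](counitl x) /tlift (linear_map_sum _ _ eL).
by apply: eq_bigr => p _; rewrite (linear_mapZ _ _ eL).
Qed.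

(** * Normality and commutation of the two factors *)

Section HopfSub.
Variables (k : fieldType) (H : hopfAlgType k).
Implicit Types A L : hopfSubalg H.

Lemma hsub_mem A (x : hsub A) : hval x \in A.
Proof. exact: valP. Qed.

Lemma tlift_mem (U V : lmodType k) (F : U -> V -> H) (t : tensor U V) A :
  (forall u v, F u v \in A) -> tlift F t \in A.
Proof. by move=> FA; apply: rpred_sum => p _. Qed.

Lemma hsub_ad_mem A L (a : H) (l : hsub L) : normal_hopf_subalg A -> a \in A ->
  \tsum_(l1, l2 <- comul l) (hval l1 * a * antip (hval l2)) \in A.
Proof.
move=> nA aA; have [+ _] := nA (hval l) a aA.
rewrite hval_comul tlift_hval //.
exact: mul_bilin (@mulr_linear k H a) (@antip_linear k H).
Qed.

Section Factorization.
Variables A L : hopfSubalg H.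
Local Notation AL := (tensor (hsub A) (hsub L)).

Let vA := @hval_linear k H A.
Let vL := @hval_linear k H L.

Let mult_bilin : bilin (fun (a : hsub A) (l : hsub L) => hval a * hval l).
Proof. exact: mul_bilin. Qed.

Let opmult_bilin : bilin (fun (a : hsub A) (l : hsub L) => hval l * hval a).
Proof.
by have [hl hr] := mul_bilin vL vA; split=> x; [exact: hr|exact: hl].
Qed.

Let SvA : linear (fun a : hsub A => antip (hval a)).
Proof. exact: linear_comp (@antip_linear k H) vA. Qed.
Let SvL : linear (fun l : hsub L => antip (hval l)).
Proof. exact: linear_comp (@antip_linear k H) vL. Qed.

Let antip_bilin :
  bilin (fun (a : hsub A) (l : hsub L) => antip (hval a) * antip (hval l)).
Proof. exact: mul_bilin. Qed.

(** Since S reverses products, [opmult_inv] is S after [opmult_map]; spelling it as S(a)S(l) avoids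
    having to prove that reversal. *)
Definition opmult_map (t : AL) : H := \tsum_(a, l <- t) (hval l * hval a).
Definition opmult_inv (t : AL) : H :=
  \tsum_(a, l <- t) (antip (hval a) * antip (hval l)).

Lemma mult_map_linear : linear (mult_map A L).
Proof. exact: tlift_linear. Qed.
Lemma opmult_map_linear : linear opmult_map.
Proof. exact: tlift_linear. Qed.
Lemma opmult_inv_linear : linear opmult_inv.
Proof. exact: tlift_linear. Qed.

Lemma mult_mapE a l : mult_map A L (a \ox l) = hval a * hval l.
Proof. exact: tliftE. Qed.

Lemma mem_both_scalar (x : H) : injective (mult_map A L) ->
  x \in A -> x \in L -> x = (counit x)%:A.
Proof.
move=> inj xA xL.
pose a : hsub A := Sub x xA; pose l : hsub L := Sub x xL.
have av : hval a = x by rewrite /hval SubK.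
have lv : hval l = x by rewrite /hval SubK.
have /inj e : mult_map A L (a \ox 1) = mult_map A L (1 \ox l).
  by rewrite !mult_mapE !hval1 mulr1 mul1r av lv.
(* This is id ⊗ e: it sends a ⊗ 1 to x and 1 ⊗ l to e(x)1. *)
have FB : bilin (fun (a : hsub A) (l : hsub L) => counit l *: hval a).
  split=> [b|b] c y z /=; first by rewrite vA scalerDr !scalerA mulrC.
  by rewrite counit_linear scalerDl scalerA.
have := congr1 (tlift (fun (a : hsub A) (l : hsub L) => counit l *: hval a)) e.
by rewrite !tliftE // counit1 scale1r av hval1 -hval_counit lv.
Qed.

Lemma conv_opmult_inv : conv opmult_inv opmult_map =1 conv1.
Proof.
apply: tensor_ext.
- exact: conv_linear opmult_inv_linear opmult_map_linear.
- exact: conv1_linear.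
move=> a l; rewrite /conv tensor_comulE tlift_tmid; last first.
  exact: mul_bilin opmult_inv_linear opmult_map_linear.
rewrite /conv1 tensor_counitE.
(* In S(a1) S(l1) l2 a2 the inner pair collapses first, to e(l); then S(a1) a2 collapses to e(a). *)
transitivity (\tsum_(a1, a2 <- comul a)
    (antip (hval a1) * (counit l)%:A * hval a2)).
  apply: tlift_eq => a1 a2; rewrite -hval_counit -antipl hval_comul tlift_hval.
    rewrite /tlift mulr_sumr mulr_suml; apply: eq_bigr => p _.
    by rewrite /opmult_inv /opmult_map !tliftE //= !mulrA.
  exact: antip_mul_bilin (@antip_linear k H).
rewrite [counit a * _]mulrC -scalerA -(hval_counit a) -(antipl (hval a)).
rewrite hval_comul tlift_hval.
  rewrite /tlift scaler_sumr; apply: eq_bigr => p _.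
  by rewrite -scalerAr mulr1 -scalerAl.
exact: antip_mul_bilin (@antip_linear k H).
Qed.

(* The generalised commutator a1 l1 S(a2) S(l2) lies in A, as                 *)
(* a1 (l1 S(a2) S(l2)), and in L, as (a1 l1 S(a2)) S(l2): it is a scalar.     *)
Lemma conv_mult_opmult_inv : injective (mult_map A L) ->
  normal_hopf_subalg A -> normal_hopf_subalg L ->
  conv (mult_map A L) opmult_inv =1 conv1.
Proof.
move=> inj nA nL; apply: tensor_ext.
- exact: conv_linear mult_map_linear opmult_inv_linear.
- exact: conv1_linear.
move=> a l; rewrite /conv tensor_comulE tlift_tmid; last first.
  exact: mul_bilin mult_map_linear opmult_inv_linear.
pose F (a1 a2 : hsub A) (l1 l2 : hsub L) :=
  hval a1 * hval l1 * antip (hval a2) * antip (hval l2).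
transitivity
  (\tsum_(a1, a2 <- comul a) \tsum_(l1, l2 <- comul l) F a1 a2 l1 l2).
  apply: tlift_eq => a1 a2; apply: tlift_eq => l1 l2.
  by rewrite mult_mapE /opmult_inv tliftE // /F !mulrA.
set c := (X in X = _).
have cA : c \in A.
  apply: tlift_mem => a1 a2.
  have -> : tlift (F a1 a2) (comul l) = hval a1 *
      \tsum_(l1, l2 <- comul l) (hval l1 * antip (hval a2) * antip (hval l2)).
    by rewrite /tlift mulr_sumr; apply: eq_bigr => p _; rewrite /F !mulrA.
  apply: rpredM; first exact: hsub_mem.
  by apply: hsub_ad_mem => //; apply: antip_closed; exact: hsub_mem.
have cL : c \in L.
  rewrite /c (tlift_exchange F); apply: tlift_mem => l1 l2.
  rewrite /tlift -mulr_suml; apply: rpredM.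
    exact: (hsub_ad_mem a nL (hsub_mem l1)).
  by apply: antip_closed; exact: hsub_mem.
rewrite (mem_both_scalar inj cA cL) /conv1; congr (_ *: _).
(* The counit is multiplicative and e S = e, so e(c) is the sum of e(a1)e(a2)e(l1)e(l2), which is
   e(a)e(l). *)
have eL : linear (counit : H -> k^o) by exact: counit_linear.
rewrite tensor_counitE -(sum_counit a) -(sum_counit l) mulr_suml.
rewrite /c /tlift (linear_map_sum _ _ eL); apply: eq_bigr => p _.
rewrite mulr_sumr (linear_map_sum _ _ eL); apply: eq_bigr => q _.
rewrite /F !counitM !counit_antip !hval_counit -!mulrA; congr (_ * _).
exact: mulrCA.
Qed.

Lemma factorization_commute : injective (mult_map A L) ->
  normal_hopf_subalg A -> normal_hopf_subalg L ->
  forall (a : hsub A) (l : hsub L), hval a * hval l = hval l * hval a.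
Proof.
move=> inj nA nL a l; have /(_ (a \ox l)) := conv_inv_uniq mult_map_linear
  opmult_inv_linear opmult_map_linear (conv_mult_opmult_inv inj nA nL)
  conv_opmult_inv.
by rewrite mult_mapE /opmult_map tliftE.
Qed.

(** * Multiplication as a Hopf algebra morphism *)

Section Commuting.
Hypothesis comm : forall (a : hsub A) (l : hsub L),
  hval a * hval l = hval l * hval a.

Let f := mult_map A L.
Let fL : linear f. Proof. exact: mult_map_linear. Qed.

Lemma mult_map1 : f 1 = 1.
Proof. by rewrite /f tensor_1E mult_mapE !hval1 mulr1. Qed.

(** Commutation enters here, to exchange l and a' in a l a' l'. *)
Lemma mult_mapM : {morph f : x y / x * y}.
Proof.
apply: bilin_ext.
- exact: (linear_bilin fL (@alg_mul_bilin _ _)).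
- exact: mul_bilin fL fL.
move=> a l a' l'; rewrite tensor_mulE /f !mult_mapE !hvalM.
by rewrite -!mulrA; congr (_ * _); rewrite !mulrA comm.
Qed.

(** The coproduct of H is multiplicative, and (a1 ⊗ a2)(l1 ⊗ l2) = a1 l1 ⊗ a2 l2 is the image under
    f ⊗ f of the shuffled tensor. *)
Lemma mult_map_comul (x : AL) : comul (f x) = tmap f f (comul x).
Proof.
move: x; apply: tensor_ext.
- exact: linear_comp (@comul_linear k H) fL.
- exact: linear_comp (tmap_linear fL fL) (@comul_linear k AL).
move=> a l; rewrite tensor_comulE /f mult_mapE comulM !hval_comul.
move: (comul a) (comul l); apply: bilin_ext.
- exact: mul_bilin (tmap_linear vA vA) (tmap_linear vL vL).
- exact: linear_bilin (tmap_linear fL fL) (@tmid_bilin _ _ _ _ _).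
move=> a1 a2 l1 l2; rewrite tmidE !tmapE // -/f; try exact: fL.
by rewrite tensor_mulE /f !mult_mapE.
Qed.

Lemma mult_map_counit (x : AL) : counit (f x) = counit x.
Proof.
move: x; apply: (@tensor_ext k _ _ k^o).
- exact: linear_comp (@counit_linear k H : linear (counit : H -> k^o)) fL.
- exact: (@counit_linear k AL).
by move=> a l; rewrite tensor_counitE /f mult_mapE counitM !hval_counit.
Qed.

Lemma mult_map_hopf_morphism : hopf_morphism (mult_map A L).
Proof.
split; [exact: fL|exact: mult_map1|exact: mult_mapM|exact: mult_map_comul
  |exact: mult_map_counit|].
exact: bialg_morphism_antip fL mult_map1 mult_mapM mult_map_comul
  mult_map_counit.
Qed.

End Commuting.

End Factorization.
End HopfSub.

Theorem theorem2p8 (k : closedFieldType) (hchar : [pchar k] =i pred0)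
    (H : hopfAlgType k) (A L : hopfSubalg H)
    (hfact : factorization A L)
    (hA : normal_hopf_subalg A) (hL : normal_hopf_subalg L) :
  @hopf_isomorphism k (tensor (hsub A) (hsub L)) H (mult_map A L).
Proof.
split; last exact: hfact.
apply: mult_map_hopf_morphism.
exact: factorization_commute (bij_inj hfact) hA hL.
Qed.
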